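(* Let $g,h:(0,\infty)\to\mathbb{R}$ be bounded (measurable) functions with $g\ge0$ and $$\lim_{t\to\infty}\frac1t\int_0^tg(s)\,ds=0,\qquad \lim_{t\to\infty}\frac1t\int_0^th(s)\,ds=0 .$$ Then there exist a positive increasing function $\lambda(t)$ on $(0,\infty)$ with $\lim_{t\to\infty}\lambda(t)=\infty$ and a sequence of times $\tilde t_k\to\infty$ as $k\to\infty$ such that $$\limsup_{k\to\infty}\ \sup_{\tau\in(0,\tilde t_k/4)}\frac1\tau\int_{\tilde t_k}^{\tilde t_k+\tau}\big(\lambda(s)g(s)+h(s)\big)\,ds\le0 .$$
   Context: Here ''increasing'' is in the non-strict sense. *)

(* Defs.v *)
From HB Require Import structures.
From mathcomp Require Import all_boot all_order all_algebra.
From mathcomp Require Import all_classical all_reals all_analysis.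

Set Implicit Arguments.
Unset Strict Implicit.
Unset Printing Implicit Defensive.
Import Order.TTheory GRing.Theory Num.Theory.
Import numFieldNormedType.Exports.
Local Open Scope classical_set_scope.
Local Open Scope ring_scope.

(* The carrier is R itself, but its measurable sets are the
   Lebesgue-measurable sets instead of the Borel sets that R carries by
   default; it is the domain of [completed_lebesgue_measure]. *)
Definition lebesgueTypeR (R : realType) : measurableType _ :=
  caratheodory_type (@wlength R idfun)^*%mu.

Definition lebesgue_measurable_fun (R : realType) (D : set R) (f : R -> R) :=
  measurable_fun (D : set (lebesgueTypeR R)) (f : lebesgueTypeR R -> R).

(* Main.v *)
Require Import Defs.
From HB Require Import structures.
From mathcomp Require Import all_boot all_order all_algebra.
From mathcomp Require Import all_classical all_reals all_analysis.
From mathcomp Require Import measurable_realfun ring lra.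
Set Implicit Arguments.
Unset Strict Implicit.
Unset Printing Implicit Defensive.
Import Order.TTheory GRing.Theory Num.Theory.
Import numFieldNormedType.Exports.
Local Open Scope classical_set_scope.
Local Open Scope ring_scope.

(** Two ideas combine.

    Since the averages p(t) of g over (0, t) tend to 0, a weight lambda can be
    chosen that increases to infinity so slowly that lambda(t) p(t) still
    tends to 0 ([slow_weight_exists]).  As lambda is increasing and g is
    nonnegative, the integral of lambda g over (0, t) is at most
    lambda(t) t p(t), so f = lambda g + h also has averages tending to 0: its
    primitive F satisfies F(t) = o(t).

    For such an F, fix e > 0 and maximise F(t) - e t over a window [T, 2T].
    The maximiser c is a good time: no later point of the window does better,
    and for large T no point s > 2T does either, since F(t) = o(t) makes the
    value there about -e s, below the value at T, which is about -e T.  So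
    F(c + tau) - F(c) <= e tau for every tau > 0
    ([exists_low_growth_time]).  Taking e = 1/(k+1) and T beyond k yields the
    sequence of times.

    The rest is integration theory for the completed measure: F is continuous,
    since f is bounded on bounded intervals, hence attains its maximum on the
    window, and F(b) - F(a) is the integral of f over (a, b). *)

(** * Weights growing slowly against a vanishing average *)

(** The weight is 1 / sqrt(q) made monotone, where q(s) = p(s) + 1/s: the
    infimum of 1 / sqrt(q(s)) over s >= t is increasing in t, and multiplied by
    p it is at most p / sqrt(q) <= sqrt(p).  The term 1/s keeps q positive
    where p vanishes.  The bound C keeps the infimum positive. *)
Lemma slow_weight_exists (R : realType) (p : R -> R) (C : R)
    (p_bnd : forall t, 0 < t -> 0 <= p t <= C)
    (p_cvg : p t @[t --> +oo] --> (0 : R)) :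
  exists lambda : R -> R,
    [/\ forall t, 0 < t -> 0 < lambda t,
        {homo lambda : s t / s <= t},
        lambda t @[t --> +oo] --> +oo
      & lambda t * p t @[t --> +oo] --> (0 : R)].
Proof.
pose w s := (Num.sqrt (p s + s^-1))^-1.
pose tail t := [set w s | s in [set s | t <= s /\ 0 < s]].
have w_ge0 s : 0 <= w s by rewrite invr_ge0 sqrtr_ge0.
have tail_lb t : has_lbound (tail t) by exists 0 => _ [s _ <-].
have tail_ne t : tail t !=set0.
  exists (w (Num.max t 1)), (Num.max t 1) => //=.
  by split; rewrite le_max lexx || rewrite lt_max ltr01 orbT.
have le_w t : 0 < t -> inf (tail t) <= w t.
  by move=> t0; apply: ge_inf => //; exists t.
have inv_le_w s e : 0 < s -> 0 < e -> p s + s^-1 <= e ^+ 2 -> e^-1 <= w s.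
  move=> s0 e0 le_e; have s1 : 0 < s^-1 by rewrite invr_gt0.
  have /andP[p0 _] := p_bnd _ s0.
  rewrite lef_pV2 ?posrE ?sqrtr_gt0 ?ltr_wpDl//.
  by rewrite -(ger0_norm (ltW e0)) -sqrtr_sqr ler_wsqrtr.
exists (fun t => inf (tail t)); split.
- move=> t t0.
  have C0 : 0 <= C by have /andP[a b] := p_bnd _ t0; exact: le_trans b.
  have t1 : 0 < t^-1 by rewrite invr_gt0.
  pose e := C + t^-1 + 1.
  have e0 : 0 < e by rewrite /e; lra.
  apply: (@lt_le_trans _ _ e^-1); first by rewrite invr_gt0.
  apply: lb_le_inf => // _ [s [ts s0] <-]; apply: inv_le_w => //.
  have /andP[_ pC] := p_bnd _ s0.
  have st : s^-1 <= t^-1 by rewrite lef_pV2.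
  by rewrite /e; nra.
- move=> s t st; apply: lb_le_inf => // _ [r [tr r0] <-].
  by apply: ge_inf => //; exists r => //; split => //; exact: le_trans tr.
- apply/cvgryPge => A.
  pose e := (`|A| + 1)^-1.
  have e0 : 0 < e by rewrite invr_gt0 ltr_wpDl.
  have e20 : 0 < e ^+ 2 / 2 by rewrite divr_gt0// exprn_gt0.
  have /cvgr0Pnorm_le/(_ _ e20)[M [_ pM]] := p_cvg.
  near=> t.
  apply: (@le_trans _ _ e^-1).
    by rewrite /e invrK (le_trans (ler_norm A))// lerDl.
  apply: lb_le_inf => // _ [s [ts s0] <-]; apply: inv_le_w => //.
  have : `|p s| <= e ^+ 2 / 2.
    apply: pM; apply: lt_le_trans ts.
    by near: t; apply: nbhs_pinfty_gt; rewrite num_real.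
  move=> /ler_normlW ps.
  have : s^-1 <= e ^+ 2 / 2.
    rewrite -[leRHS]invrK lef_pV2 ?posrE ?invr_gt0//; apply: le_trans ts.
    by near: t; apply: nbhs_pinfty_ge; rewrite num_real.
  by lra.
- apply/cvgr0Pnorm_le => e e0.
  have e20 : 0 < e ^+ 2 by rewrite exprn_gt0.
  have /cvgr0Pnorm_le/(_ _ e20) p_le := p_cvg.
  near=> t.
  have t0 : 0 < t by near: t; apply: nbhs_pinfty_gt; rewrite num_real.
  have /andP[p0 _] := p_bnd _ t0.
  have q0 : 0 < p t + t^-1 by rewrite ltr_wpDl ?invr_gt0.
  have pe : p t <= e ^+ 2 by rewrite -(ger0_norm p0); near: t.
  rewrite ger0_norm; last first.
    by rewrite mulr_ge0//; apply: lb_le_inf => // _ [s _ <-].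
  apply: (@le_trans _ _ (w t * p t)); first by rewrite ler_wpM2r// le_w.
  rewrite /w mulrC ler_pdivrMr ?sqrtr_gt0//.
  rewrite -[X in X <= _](sqr_sqrtr p0) expr2 ler_pM ?sqrtr_ge0//.
    by rewrite -(ger0_norm (ltW e0)) -sqrtr_sqr ler_wsqrtr.
  by rewrite ler_wsqrtr// lerDl invr_ge0 ltW.
Unshelve. all: by end_near. Qed.

(** * Times after which a sublinear function grows slowly *)

(** A maximiser over [T, 2T] of G(t) = F(t) - e t works.  With
    |F(t)| <= (e/3) t for t >= T, a point s > 2T satisfies
    G(s) <= -(2e/3) s < -(4e/3) T <= G(T), so leaving the window never helps;
    e/3 is the largest slope for which this holds. *)
Lemma exists_low_growth_time (R : realType) (F : R -> R) (e N : R)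
    (F_cont : forall a b, 0 < a -> a <= b -> {within `[a, b], continuous F})
    (F_avg : t^-1 * F t @[t --> +oo] --> (0 : R)) (e0 : 0 < e) :
  exists t, [/\ 0 < t, N <= t &
    forall tau, 0 < tau -> F (t + tau) - F t <= e * tau].
Proof.
have d0 : 0 < e / 3 by lra.
have /cvgr0Pnorm_le/(_ _ d0)[M [_ F_small]] := F_avg.
pose T := Num.max (Num.max M N) 0 + 1.
have MT : M < T by rewrite /T ltr_pwDr// !le_max lexx.
have NT : N <= T by rewrite /T ler_wpDr// !le_max lexx !orbT.
have T0 : 0 < T by rewrite /T ltr_pwDr// le_max lexx orbT.
have F_le t : T <= t -> `|F t| <= e / 3 * t.
  move=> Tt; have t0 := lt_le_trans T0 Tt.
  have := F_small t (lt_le_trans MT Tt).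
  rewrite normrM (@ger0_norm _ t^-1); last by rewrite invr_ge0 ltW.
  by rewrite ler_pdivrMl// mulrC.
have T2T : T <= T + T by lra.
pose G t := F t - e * t.
have [|c /[!in_itv]/= /andP[Tc c2T] Gmax] := @EVT_max R G T (T + T) T2T.
  move=> x; apply: cvgB; first exact: F_cont.
  by apply: continuous_subspaceT => y; exact: mulrl_continuous.
have Tmem : T \in `[T, T + T] by rewrite in_itv/= lexx.
exists c; split; [exact: lt_le_trans Tc|exact: le_trans Tc|move=> tau tau0].
suff : G (c + tau) <= G c by rewrite /G; lra.
have [short|long] := leP (c + tau) (T + T).
  by apply: Gmax; rewrite in_itv/= short andbT; lra.
apply: le_trans (Gmax _ Tmem); rewrite /G.
have /F_le/ler_normlP[_ h1] : T <= c + tau by lra.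
have /F_le/ler_normlP[h2 _] := lexx T.
by nra.
Qed.

(** * Integration over bounded intervals for the completed measure *)

Lemma borel_lebesgue_measurable (R : realType) (A : set R) :
  measurable A -> measurable (A : set (lebesgueTypeR R)).
Proof. exact: sub_caratheodory. Qed.

Lemma completed_lebesgue_measure_itvoo (R : realType) (a b : R) : a <= b ->
  completed_lebesgue_measure (`]a, b[%classic : set R) = (b - a)%:E.
Proof.
(* Both measures are the same outer measure, on different sigma-algebras. *)
move=> ab; rewrite [LHS](_ : _ = lebesgue_measure (`]a, b[%classic : set R))//.
rewrite lebesgue_measure_itv/= lte_fin.
move: ab; rewrite le_eqVlt => /predU1P[->|->]; last by rewrite EFinB.
by rewrite ltxx subrr.
Qed.

Lemma integrable_itvoo (R : realType) (f : R -> R) (K a b : R) :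
  0 <= a -> lebesgue_measurable_fun `]0, +oo[ f ->
  (forall s, 0 < s -> s < b -> `|f s| <= K) ->
  completed_lebesgue_measure.-integrable `]a, b[ (EFin \o f).
Proof.
move=> a0 mf fK.
apply: (@measurable_bounded_integrable _ (lebesgueTypeR R)).
- exact: borel_lebesgue_measurable.
- have [ab|ba] := leP a b.
    by rewrite [ltLHS](completed_lebesgue_measure_itvoo ab) ltry.
  by rewrite set_itv_ge ?measure0// bnd_simp -leNgt ltW.
- apply: measurable_funS mf; first exact: borel_lebesgue_measurable.
  move=> s/=; rewrite !in_itv/= andbT => /andP[as_ _].
  exact: le_lt_trans as_.
- exists K; split; first exact: num_real.
  move=> M KM s/=; rewrite in_itv/= => /andP[as_ sb].
  by rewrite (le_trans _ (ltW KM))// fK// (le_lt_trans a0).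
Qed.

(** The two open intervals miss only the null point a. *)
Lemma Rintegral_itvoo_split (R : realType) (f : R -> R) (K a b : R) :
  0 < a -> a <= b -> lebesgue_measurable_fun `]0, +oo[ f ->
  (forall s, 0 < s -> s < b -> `|f s| <= K) ->
  \int[completed_lebesgue_measure]_(s in `]0, b[) f s =
  \int[completed_lebesgue_measure]_(s in `]0, a[) f s +
  \int[completed_lebesgue_measure]_(s in `]a, b[) f s.
Proof.
move=> a0 ab mf fK.
have fi := integrable_itvoo (lexx 0) mf fK.
have mitv x y : measurable (`]x, y[%classic : set (lebesgueTypeR R)).
  exact: borel_lebesgue_measurable.
have ma : measurable ([set a] : set (lebesgueTypeR R)).
  exact: borel_lebesgue_measurable.
have itvE : `]0, b[ `\` [set a] = `]0, a[ `|` `]a, b[ :> set (lebesgueTypeR R).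
  apply/seteqP; split => s /=; rewrite !in_itv/=.
    by case=> /andP[s0 sb] /eqP; rewrite neq_lt => /orP[sa|sa]; [left|right];
      apply/andP.
  by case=> /andP[h1 h2]; split; first [apply/andP; split; lra | move=> ?; lra].
rewrite /Rintegral (@negligible_integral _ (lebesgueTypeR R) R _ _ [set a])//;
  last first.
  by rewrite [LHS](_ : _ = lebesgue_measure [set a])// lebesgue_measure_set1.
rewrite itvE -/(Rintegral _ _ _) (@Rintegral_setU _ (lebesgueTypeR R))//.
  apply: integrableS fi => //; first exact: measurableU.
  by rewrite -itvE; exact: subDsetl.
apply/disj_setPS => s /= []; rewrite !in_itv/= => /andP[_ h1] /andP[h2 _].
by move: (lt_trans h1 h2); rewrite ltxx.
Qed.

Lemma normr_Rintegral_itvoo_le (R : realType) (f : R -> R) (K a b : R) :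
  0 <= a -> a <= b -> lebesgue_measurable_fun `]0, +oo[ f ->
  (forall s, 0 < s -> s < b -> `|f s| <= K) ->
  `|\int[completed_lebesgue_measure]_(s in `]a, b[) f s| <= K * (b - a).
Proof.
move=> a0 ab mf fK.
have fi := integrable_itvoo a0 mf fK.
have mab : measurable (`]a, b[%classic : set (lebesgueTypeR R)).
  exact: borel_lebesgue_measurable.
apply: le_trans (le_normr_Rintegral mab fi) _.
rewrite [leRHS](_ : _ = \int[completed_lebesgue_measure]_(s in `]a, b[) K).
  apply: le_Rintegral => //.
  - exact: integrable_norm.
  - by apply: (@integrable_itvoo _ (cst K) `|K|) => //; exact: measurable_cst.
  - move=> s /=; rewrite in_itv/= => /andP[as_ sb].
    by rewrite fK// (le_lt_trans a0).
by rewrite Rintegral_cst// [X in fine X](completed_lebesgue_measure_itvoo ab).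
Qed.

(** A bound K for f on (0, b) makes the primitive K-Lipschitz on [a, b]. *)
Lemma primitive_continuous (R : realType) (f : R -> R)
    (mf : lebesgue_measurable_fun `]0, +oo[ f)
    (f_bnd : forall t : R, exists K : R,
       forall s : R, 0 < s -> s < t -> `|f s| <= K)
    (a b : R) (a0 : 0 < a) (ab : a <= b) :
  {within `[a, b],
    continuous (fun t => \int[completed_lebesgue_measure]_(s in `]0, t[) f s)}.
Proof.
have [K fK] := f_bnd b.
pose F (t : R) : R :=
  \int[completed_lebesgue_measure]_(s in `]0, t[) f s.
have F_lip x y : a <= x -> x <= y -> y <= b -> `|F y - F x| <= K * (y - x).
  move=> ax xy yb; have x0 := lt_le_trans a0 ax.
  have fKy s : 0 < s -> s < y -> `|f s| <= K.
    by move=> s0 sy; apply: fK => //; exact: lt_le_trans yb.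
  rewrite /F (Rintegral_itvoo_split x0 xy mf fKy) addrAC subrr add0r.
  by apply: normr_Rintegral_itvoo_le => //; exact: ltW.
apply/subspace_continuousP => x; rewrite /= in_itv/= => /andP[ax xb].
apply/cvgrPdist_le => e e0; rewrite near_withinE.
(* K itself may vanish, so the modulus of continuity divides by |K| + 1. *)
have d0 : 0 < e / (`|K| + 1) by rewrite divr_gt0// ltr_wpDl.
near=> y; rewrite /= in_itv/= => /andP[ay yb].
have xy : `|x - y| <= e / (`|K| + 1).
  by near: y; apply: cvgr_dist_le => //; exact: cvg_id.
have : (`|K| + 1) * `|x - y| <= e.
  by rewrite mulrC -ler_pdivlMr// ltr_wpDl.
have KK : K <= `|K| + 1 by rewrite (le_trans (ler_norm K))// lerDl.
apply: le_trans; apply: (@le_trans _ _ (K * `|x - y|)); last first.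
  by rewrite ler_wpM2r.
have [le_xy|/ltW le_yx] := leP x y.
  by rewrite distrC (distrC x) (ger0_norm (_ : 0 <= y - x)) ?subr_ge0// F_lip.
by rewrite (ger0_norm (_ : 0 <= x - y)) ?subr_ge0// F_lip.
Unshelve. all: by end_near. Qed.

Lemma borel_lebesgue_measurable_fun (R : realType) (D : set R) (f : R -> R) :
  measurable D -> measurable_fun D f -> lebesgue_measurable_fun D f.
Proof.
by move=> mD mf _ A mA; apply: borel_lebesgue_measurable; exact: mf.
Qed.

(** * Extraction of the sequence of times *)

Lemma limn_esup_le0 (R : realType) (u : nat -> \bar R) :
  (forall k, (u k <= (k.+1%:R^-1)%:E)%E) -> (limn_esup u <= 0)%E.
Proof.
move=> u_le; rewrite limn_esup_lim; apply/lee_addgt0Pr => e e0; rewrite add0e.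
apply: lime_le; first exact: is_cvg_esups.
near=> n; apply: ge_ereal_sup => _ [k /= nk <-].
apply: le_trans (u_le k) _; rewrite lee_fin.
apply: (@le_trans _ _ n.+1%:R^-1); first by rewrite lef_pV2 ?posrE// ler_nat.
by near: n; apply: filterS (near_infty_natSinv_lt (PosNum e0)) => m /ltW.
Unshelve. all: by end_near. Qed.

Theorem lemma4p3 (R : realType) (g h : R -> R)
  (mg : lebesgue_measurable_fun `]0, +oo[ g)
  (mh : lebesgue_measurable_fun `]0, +oo[ h)
  (bg : [bounded g t | t in `]0, +oo[%classic])
  (bh : [bounded h t | t in `]0, +oo[%classic])
  (g0 : forall t, 0 < t -> 0 <= g t)
  (limg : t^-1 * (\int[completed_lebesgue_measure]_(s in `]0, t[) g s)
            @[t --> +oo] --> (0 : R))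
  (limh : t^-1 * (\int[completed_lebesgue_measure]_(s in `]0, t[) h s)
            @[t --> +oo] --> (0 : R)) :
  exists (lambda : R -> R) (tt : nat -> R),
    [/\ forall t, 0 < t -> 0 < lambda t,
        forall s t, 0 < s -> s <= t -> lambda s <= lambda t
      & lambda t @[t --> +oo] --> +oo] /\
    [/\ forall k, 0 < tt k,
        tt k @[k --> \oo] --> +oo
      & (limn_esup (fun k => ereal_sup
          [set (tau^-1 * \int[completed_lebesgue_measure]_(s in
                 `]tt k, (tt k + tau)[) (lambda s * g s + h s))%:E
             | tau in `]0%R, (tt k / 4)%R[]) <= 0)%E].
Proof.
have bounded_cst (u : R -> R) : [bounded u t | t in `]0, +oo[%classic] ->
    exists C : R, forall s : R, 0 < s -> `|u s| <= C.
  move=> [M [_ uM]]; exists (`|M| + 1) => s s0.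
  apply: (uM (`|M| + 1)); first by rewrite ltr_pwDr// ler_norm.
  by rewrite /= in_itv/= andbT.
have [Cg gC] := bounded_cst _ bg.
have [Ch hC] := bounded_cst _ bh.
pose p (t : R) : R :=
  t^-1 * \int[completed_lebesgue_measure]_(s in `]0, t[) g s.
have intg_ge0 (t : R) :
    0 <= \int[completed_lebesgue_measure]_(s in `]0, t[) g s.
  by apply: Rintegral_ge0 => s /=; rewrite in_itv/= => /andP[/g0].
have p_bnd t : 0 < t -> 0 <= p t <= Cg.
  move=> t0; rewrite mulr_ge0 ?invr_ge0 ?(ltW t0)//= ler_pdivrMl// mulrC.
  rewrite -[X in _ * X]subr0 (le_trans (ler_norm _))//.
  apply: normr_Rintegral_itvoo_le => //; first exact: ltW.
  by move=> s s0 _; exact: gC.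
have [lambda [lambda_gt0 lambda_homo lambda_cvg lambda_p]] :=
  slow_weight_exists p_bnd limg.
have mlambda : lebesgue_measurable_fun `]0, +oo[ lambda.
  apply: borel_lebesgue_measurable_fun => //.
  exact: nondecreasing_measurable.
pose lg s := lambda s * g s; pose f s := lg s + h s.
have mlg : lebesgue_measurable_fun `]0, +oo[ lg by exact: measurable_funM.
have mf : lebesgue_measurable_fun `]0, +oo[ f by exact: measurable_funD.
have lg_bnd (t s : R) : 0 < s -> s < t -> `|lg s| <= lambda t * Cg.
  move=> s0 st; rewrite normrM ler_pM// ?gC//.
  by rewrite gtr0_norm ?lambda_gt0// lambda_homo// ltW.
have f_bnd (t : R) : exists K : R, forall s : R, 0 < s -> s < t -> `|f s| <= K.
  exists (lambda t * Cg + Ch) => s s0 st.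
  by rewrite (le_trans (ler_normD _ _))// lerD ?lg_bnd// hC.
pose F (t : R) : R :=
  \int[completed_lebesgue_measure]_(s in `]0, t[) f s.
have F_avg : t^-1 * F t @[t --> +oo] --> (0 : R).
  pose L (t : R) : R :=
    t^-1 * \int[completed_lebesgue_measure]_(s in `]0, t[) lg s.
  (* As lambda is increasing and g >= 0, 0 <= L t <= lambda t * p t. *)
  have L_cvg : L t @[t --> +oo] --> (0 : R).
    apply: (squeeze_cvgr _ (cvg_cst 0) lambda_p).
    near=> t.
    have t0 : 0 < t by near: t; apply: nbhs_pinfty_gt; rewrite num_real.
    rewrite mulr_ge0 ?invr_ge0 ?(ltW t0)//=; last first.
      apply: Rintegral_ge0 => s /=; rewrite in_itv/= => /andP[s0 _].
      by rewrite mulr_ge0 ?g0// ltW// lambda_gt0.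
    rewrite /L /p mulrCA ler_pM2l ?invr_gt0//.
    have gi : completed_lebesgue_measure.-integrable `]0, t[ (EFin \o g).
      by apply: (@integrable_itvoo _ _ Cg) => // s s0 _; exact: gC.
    have m0t : measurable (`]0, t[%classic : set (lebesgueTypeR R)).
      exact: borel_lebesgue_measurable.
    rewrite -RintegralZl//; apply: le_Rintegral => //.
    - by apply: integrable_itvoo mlg (lg_bnd t).
    - apply: (@integrable_itvoo _ _ (lambda t * Cg)) => //.
        exact: measurable_funM.
      move=> s s0 st; rewrite normrM ler_pM ?gC//.
      by rewrite gtr0_norm ?lambda_gt0// (lt_trans s0).
    - move=> s /=; rewrite in_itv/= => /andP[s0 st].
      by rewrite ler_wpM2r ?g0// lambda_homo// ltW.
  rewrite -[X in _ --> X]addr0; apply: cvg_trans (cvgD L_cvg limh).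
  apply: near_eq_cvg; near=> t.
  rewrite /L /F -mulrDr RintegralD//.
  - exact: borel_lebesgue_measurable.
  - by apply: integrable_itvoo mlg (lg_bnd t).
  - by apply: (@integrable_itvoo _ _ Ch) => // s s0 _; exact: hC.
have low_time (k : nat) : exists t : R, [/\ 0 < t, k%:R <= t &
    forall tau, 0 < tau -> F (t + tau) - F t <= k.+1%:R^-1 * tau].
  apply: exists_low_growth_time => //.
  exact: (primitive_continuous mf f_bnd).
have [tt tt_low] := choice low_time.
exists lambda, tt; split; first by split => // s t _; exact: lambda_homo.
split.
- by move=> k; have [] := tt_low k.
- apply/cvgryPge => A; near=> k; have [_ + _] := tt_low k; apply: le_trans.
  by near: k; exact: nbhs_infty_ger.
- apply: limn_esup_le0 => k; apply: ge_ereal_sup => _ [tau /= + <-].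
  rewrite in_itv/= => /andP[tau0 _]; have [t0 _ low] := tt_low k.
  have [K fK] := f_bnd (tt k + tau).
  have t_le : tt k <= tt k + tau by rewrite lerDl ltW.
  rewrite lee_fin ler_pdivrMl// mulrC; apply: le_trans (low _ tau0).
  by rewrite /F (Rintegral_itvoo_split t0 t_le mf fK) addrAC subrr add0r.
Unshelve. all: by end_near. Qed.
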